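(* Let $\Gamma=(V,E)$ be a point-symmetric, reflexive, locally finite relation and let $v\in V$. Let $j\ge 1$ be an integer such that $\Gamma^j(v)\cap\Gamma^{-}(v)=\{v\}$. Then $$|\Gamma^{j}(v)|\ge|\Gamma^{j-1}(v)|+|\Gamma(v)|-1.$$
   Context: A relation is a pair $\Gamma=(V,E)$ with $V$ a (possibly infinite) set and $E\subseteq V\times V$. It is reflexive if $(x,x)\in E$ for all $x\in V$. For $a\in V$, $\Gamma(a)=\{x:(a,x)\in E\}$, and for $A\subseteq V$, $\Gamma(A)=\bigcup_{x\in A}\Gamma(x)$. $\Gamma$ is locally finite if $\Gamma(x)$ is finite for every $x\in V$. $\Gamma^k$ denotes the $k$-fold composition of $\Gamma$ with itself (so $\Gamma^k(a)=\Gamma(\Gamma^{k-1}(a))$), and $\Gamma^0$ is the identity relation, so $\Gamma^0(v)=\{v\}$. The reverse relation is $\Gamma^-=(V,E^-)$ with $E^-=\{(x,y):(y,x)\in E\}$; thus $\Gamma^-(v)=\{x:(x,v)\in E\}$. An automorphism of $\Gamma$ is a bijection $f:V\to V$ such that $(x,y)\in E$ if and only if $(f(x),f(y))\in E$. $\Gamma$ is point-symmetric if for all $x,y\in V$ there is an automorphism $f$ of $\Gamma$ with $f(x)=y$. *)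

(* Defs.v *)
From mathcomp Require Import all_boot finmap.
From mathcomp Require Import boolp classical_sets functions cardinality.

Set Implicit Arguments.
Unset Strict Implicit.
Unset Printing Implicit Defensive.

Local Open Scope classical_set_scope.
Local Open Scope relation_scope.

(* A relation Gamma = (V, E) on a type V is given by its edge set
   E : set (V * V). Gamma(a) is [xsection E a], the reverse relation is [E^-1],
   and the identity relation is [diagonal]. *)

(* [B \; A] in relation_scope applies A first: it relates x to y when
   A (x, z) and B (z, y) for some z. *)
Definition relpow (V : Type) (E : set (V * V)) (k : nat) : set (V * V) :=
  iter k (fun R => E \; R) diagonal.

Definition rel_reflexive (V : Type) (E : set (V * V)) : Prop :=
  forall x, E (x, x).

Definition locally_finite_rel (V : Type) (E : set (V * V)) : Prop :=
  forall x, finite_set (xsection E x).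

Definition rel_automorphism (V : Type) (E : set (V * V)) (f : V -> V) : Prop :=
  bijective f /\ forall x y, E (x, y) <-> E (f x, f y).

Definition point_symmetric (V : Type) (E : set (V * V)) : Prop :=
  forall x y, exists2 f, rel_automorphism E f & f x = y.

(* The number of elements of a finite set (0 by convention on infinite sets);
   {classic V} is V with a classical choiceType structure, as required by
   fset_set. *)
Definition ncard (V : Type) (A : set V) : nat :=
  #|` fset_set (A : set {classic V})|%fset.

Lemma ncardP (V : Type) (A : set V) :
  finite_set A -> (A #= `I_(ncard A))%card.
Proof.
move=> /finite_setP[n An].
by rewrite /ncard (@card_fset_set {classic V} A n An).
Qed.

Lemma xsection_relpow0 (V : Type) (E : set (V * V)) (a : V) :
  xsection (relpow E 0) a = [set a].
Proof.
apply/seteqP; split=> x; first by move/xsectionP => /= ax; symmetry.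
by move=> /= ->; apply/xsectionP.
Qed.

Lemma xsection_relpowS (V : Type) (E : set (V * V)) (k : nat) (a : V) :
  xsection (relpow E k.+1) a =
  \bigcup_(x in xsection (relpow E k) a) xsection E x.
Proof.
apply/seteqP; split=> y.
  by move=> /xsectionP[z az zy]; exists z; apply/xsectionP.
by move=> [z /xsectionP az /xsectionP zy]; apply/xsectionP; exists z.
Qed.

Lemma xsection_relpow1 (V : Type) (E : set (V * V)) (a : V) :
  xsection (relpow E 1) a = xsection E a.
Proof. by rewrite xsection_relpowS xsection_relpow0 bigcup_set1. Qed.

(* Main.v *)
Require Import Defs.
From mathcomp Require Import all_boot all_fingroup zify.
Set Implicit Arguments.
Unset Strict Implicit.
Unset Printing Implicit Defensive.

(* The isoperimetric method. If X contains v and the image of X meets the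
   in-neighbours of v only in v, then |Gamma(X)| >= |X| + |Gamma(v)| - 1; the
   theorem is the case X = Gamma^(j-1)(v).

   Let A be a finite nonempty set minimising |Gamma(A)| - |A| and then |A|. By
   submodularity distinct translates of A are disjoint, X may be replaced by its
   intersection with the translate containing v, and the relation induced on
   that translate is point-symmetric: this reduces to a finite V.

   For finite V let T be the complement of Gamma(X), and argue by induction on |V|
   for pairs (X, T) without edges from X to T. Among such pairs (A, B) of nonempty sets
   with |A| + |B| maximal take one whose smaller side is as small as possible;
   up to reversing the relation the smaller side is A, and it is again a block.
   Uncrossing (X, T) with (A, B) reduces to X inside A, unless the uncrossed pair
   has an empty side; there reach_block_path, applied to v, controls X outside A. *)

(** * Finite relations: symmetry and extremal separated pairs *)

Definition is_aut (V : finType) (e : rel V) (g : {perm V}) : bool :=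
  [forall a, forall b, e (g a) (g b) == e a b].

Definition vertex_transitive (V : finType) (e : rel V) : Prop :=
  forall x y, exists2 g, is_aut e g & g x = y.

Definition separated (V : finType) (e : rel V) (A B : {set V}) : Prop :=
  forall x y, x \in A -> y \in B -> ~~ e x y.

(** Applied to [(A, B)] itself, [atomic_min] gives [#|A| <= #|B|], on which uncrossing relies. *)
Record atomic (V : finType) (e : rel V) (A B : {set V}) : Prop := Atomic {
  atomic_sep : separated e A B;
  atomic_l0 : A != set0;
  atomic_r0 : B != set0;
  atomic_max : forall X Y, separated e X Y -> X != set0 -> Y != set0 ->
    #|X| + #|Y| <= #|A| + #|B|;
  atomic_min : forall X Y, separated e X Y -> X != set0 -> Y != set0 ->
    #|X| + #|Y| = #|A| + #|B| -> #|A| <= #|X| /\ #|A| <= #|Y| }.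

Section Aut.
Variables (V : finType) (e : rel V).

Lemma is_autP (g : {perm V}) : reflect (forall a b, e (g a) (g b) = e a b) (is_aut e g).
Proof.
apply: (iffP idP) => [/forallP h a b|h]; first by move: (h a) => /forallP/(_ b)/eqP.
by apply/forallP => a; apply/forallP => b; rewrite h.
Qed.

Lemma is_autV g : is_aut e g -> is_aut e g^-1%g.
Proof. by move=> /is_autP h; apply/is_autP => a b; rewrite -h !permKV. Qed.

Lemma is_autM g h : is_aut e g -> is_aut e h -> is_aut e (g * h)%g.
Proof. by move=> /is_autP hg /is_autP hh; apply/is_autP => a b; rewrite !permM hh hg. Qed.

(** Double counting of [R]: by transitivity all rows have one size and all columns have one size,
    and there are as many rows as columns. *)
Lemma invariant_card_eq (R : rel V) : vertex_transitive e ->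
  (forall g, is_aut e g -> forall a b, R (g a) (g b) = R a b) ->
  forall x y, #|[set b | R x b]| = #|[set a | R a y]|.
Proof.
move=> tr inv x y.
have row a : #|[set b | R a b]| = #|[set b | R x b]|.
  have [g ga <-] := tr x a; rewrite -[RHS](card_imset _ (@perm_inj _ g)).
  apply: eq_card => b; rewrite inE; apply/idP/imsetP => [Rb|[c]].
    by exists (g^-1%g b); rewrite ?permKV // inE -(inv _ ga) permKV.
  by rewrite inE => Rc ->; rewrite inv.
have col b : #|[set a | R a b]| = #|[set a | R a y]|.
  have [g ga <-] := tr y b; rewrite -[RHS](card_imset _ (@perm_inj _ g)).
  apply: eq_card => a; rewrite inE; apply/idP/imsetP => [Ra|[c]].
    by exists (g^-1%g a); rewrite ?permKV // inE -(inv _ ga) permKV.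
  by rewrite inE => Rc ->; rewrite inv.
have : \sum_(a : V) #|[set b | R a b]| = \sum_(b : V) #|[set a | R a b]|.
  transitivity (\sum_(a : V) \sum_(b : V) nat_of_bool (R a b)).
    apply: eq_bigr => a _; rewrite -sum1dep_card big_mkcond.
    by apply: eq_bigr => b _; case: (R a b).
  rewrite exchange_big; apply: eq_bigr => b _; rewrite -sum1dep_card [RHS]big_mkcond.
  by apply: eq_bigr => a _; case: (R a b).
rewrite (eq_bigr _ (fun a _ => row a)) (eq_bigr _ (fun b _ => col b)).
rewrite !sum_nat_const => /eqP; rewrite eqn_pmul2l; first by move/eqP.
by rewrite (cardD1 x).
Qed.

End Aut.

(** * Atomic pairs and the partition into blocks *)

Section Atomic.
Variables (V : finType) (e : rel V) (A B : {set V}).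
Hypotheses (e_refl : reflexive e) (tr : vertex_transitive e).
Hypothesis at_AB : atomic e A B.

Lemma separated_aut g X Y :
  is_aut e g -> separated e X Y -> separated e (g @: X) (g @: Y).
Proof.
by move=> /is_autP ga XY _ _ /imsetP[x xX ->] /imsetP[y yY ->]; rewrite ga; apply: XY.
Qed.

Lemma imset0_neq (g : {perm V}) (X : {set V}) : X != set0 -> g @: X != set0.
Proof. by case/set0Pn => x xX; apply/set0Pn; exists (g x); apply: imset_f. Qed.

Lemma card_imset_perm (g : {perm V}) (X : {set V}) : #|g @: X| = #|X|.
Proof. exact/card_imset/perm_inj. Qed.

Lemma atomic_aut g : is_aut e g -> atomic e (g @: A) (g @: B).
Proof.
case: at_AB => s a0 b0 mx mn ga; split; rewrite ?imset0_neq //.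
- exact: separated_aut.
- by move=> X Y; rewrite !card_imset_perm; apply: mx.
- by move=> X Y; rewrite !card_imset_perm; apply: mn.
Qed.

(** The separated pairs [(A :&: C, B :|: D)] and [(A :|: C, B :&: D)] have total size twice the
    maximum, so both are maximal, and minimality of [#|A|] forces [A :&: C] to be all of [A]. *)
Lemma atomic_uncross C D : atomic e C D -> A :&: C != set0 -> A = C.
Proof.
case: at_AB => s a0 b0 mx mn [s' c0 d0 mx' mn'] AC0.
have [AB CD] : #|A| + #|B| = #|C| + #|D| /\ #|A| = #|C|.
  have E : #|A| + #|B| = #|C| + #|D|.
    by apply/eqP; rewrite eqn_leq mx // mx'.
  by split=> //; apply/eqP; rewrite eqn_leq; case: (mn C D) => // -> _; case: (mn' A B).
have sI : separated e (A :&: C) (B :|: D).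
  by move=> x y /setIP[xA xC] /setUP[yB|yD]; [apply: s|apply: s'].
have sU : separated e (A :|: C) (B :&: D).
  by move=> x y /setUP[xA|xC] /setIP[yB yD]; [apply: s|apply: s'].
have := cardsUI A C; have := cardsUI B D => hB hA.
have BD0 : B :|: D != set0.
  by case/set0Pn: b0 => b bB; apply/set0Pn; exists b; rewrite inE bB.
have AC0' : A :|: C != set0.
  by case/set0Pn: a0 => b bB; apply/set0Pn; exists b; rewrite inE bB.
have h1 := mx _ _ sI AC0 BD0.
have [_ AleB] := mn _ _ s a0 b0 erefl.
have AC1 : 0 < #|A :&: C| by rewrite card_gt0.
(* The bound on the first pair leaves [#|B :&: D| >= #|B| - #|A| + #|A :&: C|], which is
   positive. *)
have BD1 : B :&: D != set0 by rewrite -card_gt0; lia.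
have h2 := mx _ _ sU AC0' BD1.
have [|h3 _] := mn _ _ sI AC0 BD0; first by lia.
have e1 : A :&: C = A by apply/eqP; rewrite eqEcard subsetIl h3.
by apply/eqP; rewrite eqEcard -{1}e1 subsetIr CD leqnn.
Qed.

Lemma atomic_block g : is_aut e g -> A :&: g @: A != set0 -> g @: A = A.
Proof. by move=> ga; move/(atomic_uncross (atomic_aut ga)). Qed.

(** A point outside [B] without an edge from [A] could be added to [B], against maximality of the
    sum. *)
Lemma notin_atomicr y : (y \notin B) = [exists x in A, e x y].
Proof.
case: at_AB => s a0 b0 mx mn; apply/idP/idP => [yB|/exists_inP[x xA exy]].
  apply: contraT => /exists_inPn nex.
  have /mx : separated e A (y |: B).
    by move=> x z xA /setU1P[->|/(s _ _ xA)//]; apply: nex.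
  rewrite cardsU1 yB => /(_ a0); suff: y |: B != set0 by move=> -> /(_ isT); lia.
  by apply/set0Pn; exists y; rewrite setU11.
by apply: contraL exy => yB; apply: s.
Qed.

Definition same_block x y : bool :=
  [exists g : {perm V}, [&& is_aut e g, x \in g @: A & y \in g @: A]].

(** If the translates by [h] and [g] share [x], the translate of [A] by [h * g^-1] meets [A] in
    [g^-1 x], hence equals [A]. *)
Lemma same_blockP x g : is_aut e g -> x \in g @: A ->
  forall y, same_block x y = (y \in g @: A).
Proof.
move=> ga xgA y; apply/existsP/idP => [[h /and3P[ha xh yh]]|yg]; last first.
  by exists g; rewrite ga xgA.
suff <- : h @: A = g @: A by [].
pose k := (h * g^-1)%g; have hE : h = (k * g)%g by rewrite mulgKV.
have kA : k @: A = A.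
  apply: atomic_block; first by rewrite is_autM // is_autV.
  apply/set0Pn; exists (g^-1%g x); rewrite inE.
  case/imsetP: xgA => a aA xa; rewrite xa permK aA /= -[a](permK g) -xa.
  by case/imsetP: xh => b bA ->; rewrite -permM imset_f.
rewrite -[in RHS]kA -imset_comp hE; apply: eq_imset => z /=; exact: permM.
Qed.

Lemma in_some_block x : exists2 g, is_aut e g & x \in g @: A.
Proof.
have /set0Pn[a aA] := atomic_l0 at_AB; have [g ga <-] := tr a x.
by exists g => //; apply: imset_f.
Qed.

Lemma same_block_atom x : x \in A -> forall y, same_block x y = (y \in A).
Proof.
move=> xA y; have i1 : (1%g : {perm V}) @: A = A.
  by rewrite -[RHS]imset_id; apply: eq_imset => z; rewrite perm1.
rewrite (@same_blockP _ 1%g) ?i1 //; apply/is_autP => a b; by rewrite !perm1.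
Qed.

Lemma same_block_refl x : same_block x x.
Proof. by have [g ga xg] := in_some_block x; rewrite (same_blockP ga xg). Qed.

Lemma same_block_sym x y : same_block x y = same_block y x.
Proof. by apply/existsP/existsP => -[g /and3P[a b c]]; exists g; apply/and3P. Qed.

Lemma same_block_trans x y z : same_block x y -> same_block y z = same_block x z.
Proof.
have [g ga xg] := in_some_block x; rewrite !(same_blockP ga xg) => yg.
by rewrite (same_blockP ga yg).
Qed.

Lemma same_block_aut h : is_aut e h ->
  forall x y, same_block (h x) (h y) = same_block x y.
Proof.
move=> ha x y; have [g ga xg] := in_some_block x.
have E (z : V) : (h z \in (g * h)%g @: A) = (z \in g @: A).
  have -> : (g * h)%g @: A = h @: (g @: A).
    by rewrite -imset_comp; apply: eq_imset => a /=; rewrite permM.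
  by rewrite mem_imset //; apply: perm_inj.
by rewrite (same_blockP ga xg) (@same_blockP _ (g * h)%g) ?is_autM ?E.
Qed.

Definition reach_block y w : bool := [exists z, same_block y z && e z w].

Lemma reach_block_aut h : is_aut e h ->
  forall x y, reach_block (h x) (h y) = reach_block x y.
Proof.
move=> ha x y; have /is_autP hh := ha.
apply/existsP/existsP => -[z /andP[xz zy]].
  exists (h^-1%g z); rewrite -(same_block_aut ha) permKV xz /=.
  by rewrite -hh permKV.
by exists (h z); rewrite same_block_aut // hh xz.
Qed.

(** By invariance the column of [reach_block] at [w] is as large as its row at a point of [A]; that
    row is the image of [A], the complement of [B]. *)
Lemma card_reach_block w : #|[set y | reach_block y w]| + #|B| = #|V|.
Proof.
have /set0Pn[a aA] := atomic_l0 at_AB.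
rewrite -(invariant_card_eq tr reach_block_aut a) -(cardsC B) addnC; congr addn.
apply: eq_card => y; rewrite !inE notin_atomicr.
apply/existsP/exists_inP => [[z /andP[]]|[z zA zy]].
  by rewrite same_block_atom // => zA zy; exists z.
by exists z; rewrite same_block_atom // zA.
Qed.

Lemma card_block x : #|[set y | same_block x y]| = #|A|.
Proof.
have [g ga xg] := in_some_block x; rewrite -[RHS](card_imset_perm g).
by apply: eq_card => y; rewrite inE (same_blockP ga xg).
Qed.

(** Compares [(A, B)] with a singleton of [A] paired with the complement of its out-neighbourhood,
    which contains [B] and so is nonempty. *)
Lemma atomic_card_gt w : #|V| < #|[set y | e w y]| + #|A| + #|B|.
Proof.
have /set0Pn[a aA] := atomic_l0 at_AB; have /set0Pn[b bB] := atomic_r0 at_AB.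
have -> : #|[set y | e w y]| = #|[set y | e a y]|.
  have := invariant_card_eq (R := e) tr (fun g ga => elimT (is_autP e g) ga).
  by move=> h; rewrite (h w w) -(h a w).
have s : separated e [set a] (~: [set y | e a y]).
  by move=> x y /set1P ->; rewrite !inE.
have := atomic_max at_AB s; rewrite cards1 -(cardsC [set y | e a y]).
have -> : [set a] != set0 by apply/set0Pn; exists a; rewrite inE.
have -> : ~: [set y | e a y] != set0.
  by apply/set0Pn; exists b; rewrite !inE (atomic_sep at_AB).
by move=> /(_ isT isT); lia.
Qed.

(* Otherwise the out-neighbours of x in its block C all lie in C \ in(w).
   The sets C \ in(w), in(w) minus the block of w, and the block of w are disjoint
   parts of the union of the blocks meeting in(w), which is as large as out(A) by
   double counting; this forces |out(A)| - |A| to be at least the degree, while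
   singletons show that it is smaller. *)
Lemma reach_block_path x w : reach_block x w -> ~~ same_block x w ->
  exists y, [&& same_block x y, e x y & e y w].
Proof.
move=> xw nxw; apply/existsP; apply: contraT; rewrite negb_exists => /forallP no.
have autE g : is_aut e g -> forall a b, e (g a) (g b) = e a b by move/is_autP.
pose R a b := same_block a b && e a b.
have Raut g : is_aut e g -> forall a b, R (g a) (g b) = R a b.
  by move=> ga a b; rewrite /R same_block_aut // autE.
pose C := [set y | same_block x y]; pose W := [set y | same_block y w].
pose I := [set y | e y w].
have WA : #|W| = #|A|.
  by rewrite -(card_block w); apply: eq_card => y; rewrite !inE same_block_sym.
have h1 : #|W :&: I| <= #|C :\: I|.
  have -> : #|W :&: I| = #|[set y | R x y]|.
    rewrite (invariant_card_eq tr Raut x w).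
    by apply: eq_card => y; rewrite !inE.
  apply/subset_leq_card/subsetP => y; rewrite !inE => /andP[xy exy].
  by have := no y; rewrite xy exy /= => ->.
have h2 : #|C :\: I| + #|I :|: W| <= #|[set y | reach_block y w]|.
  have d : [disjoint C :\: I & I :|: W].
    rewrite -setI_eq0; apply/eqP/setP => y; rewrite !inE.
    case: (e y w) => //=; apply/negP => /andP[xy yw].
    by move: nxw; rewrite -(same_block_trans _ xy) yw.
  have /leqifP := leq_card_setU (C :\: I) (I :|: W); rewrite d => /eqP <-.
  apply/subset_leq_card/subsetP => y; rewrite !inE => /or3P[/andP[_ xy]|yw|yw].
  - case/existsP: xw => z /andP[xz zw]; apply/existsP; exists z.
    by rewrite -(same_block_trans _ (y := x)) ?xz // same_block_sym.
  - by apply/existsP; exists y; rewrite same_block_refl.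
  - by apply/existsP; exists w; rewrite yw e_refl.
have h3 := cardsUI I W; rewrite [I :&: W]setIC in h3.
have h4 : #|I| = #|[set y | e w y]|.
  by rewrite (invariant_card_eq (R := e) tr autE w w).
have := card_reach_block w; have := atomic_card_gt w; lia.
Qed.

End Atomic.

(** Restricting [e] to pairs within a common block keeps it invariant, so double counting still
    applies. *)
Lemma card_block_in_out (V : finType) (e : rel V) (A B : {set V}) v :
  vertex_transitive e -> atomic e A B -> v \in A ->
  #|[set y | e v y] :&: A| = #|[set y | e y v] :&: A|.
Proof.
move=> tr at_AB vA; pose R a b := same_block e A a b && e a b.
have Raut g : is_aut e g -> forall a b, R (g a) (g b) = R a b.
  move=> ga a b; rewrite /R (same_block_aut tr at_AB) //.
  by congr andb; move/is_autP: ga.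
transitivity #|[set b | R v b]|.
  by apply: eq_card => y; rewrite !inE /R (same_block_atom at_AB) // andbC.
rewrite (invariant_card_eq tr Raut v v).
by apply: eq_card => y; rewrite !inE /R same_block_sym (same_block_atom at_AB) // andbC.
Qed.

(** * Reversal and the existence of atomic pairs *)

Lemma leq_lex_weight n s s' m m' : m <= n -> m' <= n ->
  s' * n.+1 + (n - m') <= s * n.+1 + (n - m) -> s' < s \/ s' = s /\ m <= m'.
Proof.
move=> mn mn'; case: (ltngtP s' s) => [|h|->]; first by left.
  by have := leq_mul h (leqnn n.+1); lia.
by rewrite leq_add2l; right; lia.
Qed.

Section Reverse.
Variables (V : finType) (e : rel V).

Definition reverse : rel V := [rel x y | e y x].

Lemma is_aut_reverse g : is_aut reverse g = is_aut e g.
Proof. by apply/is_autP/is_autP => h a b; apply: h. Qed.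

Lemma vertex_transitive_reverse : vertex_transitive e -> vertex_transitive reverse.
Proof. by move=> tr x y; have [g ga <-] := tr x y; exists g; rewrite ?is_aut_reverse. Qed.

Lemma separated_reverse X Y : separated reverse X Y <-> separated e Y X.
Proof. by split=> s x y xX yY; apply: s. Qed.

Lemma atomic_exists X Y : separated e X Y -> X != set0 -> Y != set0 ->
  exists A B, atomic e A B \/ atomic reverse A B.
Proof.
move=> sXY X0 Y0.
pose sepb (p : {set V} * {set V}) :=
  [&& [forall x in p.1, forall y in p.2, ~~ e x y], p.1 != set0 & p.2 != set0].
have sepbP (A B : {set V}) :
    separated e A B -> A != set0 -> B != set0 -> sepb (A, B).
  move=> s A0 B0; rewrite /sepb /= A0 B0 !andbT.
  by apply/forall_inP => x xA; apply/forall_inP => y; apply: s.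
(* The second summand is at most [#|V|], so maximising [w] first maximises the total size, then
   minimises the smaller side. *)
pose w (p : {set V} * {set V}) :=
  (#|p.1| + #|p.2|) * #|V|.+1 + (#|V| - minn #|p.1| #|p.2|).
case: (@arg_maxnP _ (X, Y) sepb w) => [|[A B]]; first exact: sepbP.
move=> /and3P[/= /forall_inP s A0 B0] opt.
have sAB : separated e A B by move=> x y xA; move/forall_inP: (s x xA); apply.
have mx (C D : {set V}) : separated e C D -> C != set0 -> D != set0 ->
    #|C| + #|D| < #|A| + #|B| \/
    #|C| + #|D| = #|A| + #|B| /\ minn #|A| #|B| <= minn #|C| #|D|.
  move=> sCD C0 D0; have := opt (C, D) (sepbP _ _ sCD C0 D0); rewrite /w /=.
  by apply: leq_lex_weight; rewrite geq_min !max_card.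
case: (leqP #|A| #|B|) => AB; [exists A, B; left|exists B, A; right]; split=> //.
- by move=> C D sCD C0 D0; have := mx C D sCD C0 D0; lia.
- by move=> C D sCD C0 D0; have := mx C D sCD C0 D0; lia.
- exact/separated_reverse.
- by move=> C D /separated_reverse sCD C0 D0; have := mx D C sCD D0 C0; lia.
- by move=> C D /separated_reverse sCD C0 D0; have := mx D C sCD D0 C0; lia.
Qed.

End Reverse.

Lemma atomic_translate (V : finType) (e : rel V) (A B : {set V}) v :
  vertex_transitive e -> atomic e A B ->
  exists C D, atomic e C D /\ v \in C.
Proof.
move=> tr at_AB; have /set0Pn[a aA] := atomic_l0 at_AB; have [g ga <-] := tr a v.
by exists (g @: A), (g @: B); split; [apply: atomic_aut|apply: imset_f].
Qed.

(** Finite form of the theorem, with [T] the complement of the image of [X]. Allowing any separated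
    [T] makes the statement suited to uncrossing. *)
Definition separated_bound_at (V : finType) (e : rel V) : Prop :=
  forall (X T : {set V}) v, separated e X T -> v \in X ->
  (forall u, e u v -> u != v -> u \in T) ->
  #|X| + #|T| + #|[set y | e v y]| <= #|V|.+1.

(** * The relation induced on a block *)

Section Induced.
Variables (V : finType) (e : rel V) (A : {set V}).
Local Notation S := {x | x \in A}.

Lemma card_preimset_val (X : {set V}) : #|[set u : S | val u \in X]| = #|X :&: A|.
Proof.
rewrite -(card_imset _ val_inj); apply: eq_card => x; rewrite inE.
apply/imsetP/andP => [[u]|[xX xA]]; first by rewrite inE => uX ->; split=> //; apply: valP.
by exists (Sub x xA : S); rewrite ?inE SubK.
Qed.

Lemma vertex_transitive_induced :
  (forall x y, x \in A -> y \in A ->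
     exists g, [/\ is_aut e g, g @: A = A & g x = y]) ->
  vertex_transitive (relpre (val : S -> V) e).
Proof.
move=> h x y; have [g [ga gA gxy]] := h _ _ (valP x) (valP y).
have gS (u : S) : g (val u) \in A.
  by have := imset_f g (valP u); rewrite gA.
pose f (u : S) : S := Sub (g (val u)) (gS u).
have f_inj : injective f by move=> u u' /(congr1 val); rewrite !SubK => /perm_inj/val_inj.
exists (perm f_inj); last by apply: val_inj; rewrite permE SubK.
by apply/is_autP => a b /=; rewrite !permE !SubK; move/is_autP: ga.
Qed.

(** Only the in-neighbours inside [A] must lie in [T], so [T] may have been cut down to [A]. *)
Lemma separated_bound_induced (X T : {set V}) v :
  separated_bound_at (relpre (val : S -> V) e) ->
  separated e X T -> v \in X -> v \in A ->
  (forall u, u \in A -> e u v -> u != v -> u \in T) ->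
  #|X :&: A| + #|T :&: A| + #|[set y | e v y] :&: A| <= #|A|.+1.
Proof.
move=> bd sXT vX vA inT.
have := bd [set u : S | val u \in X] [set u : S | val u \in T] (Sub v vA).
rewrite !card_preimset_val card_sig.
have -> : #|[set y : S | relpre val e (Sub v vA) y]| = #|[set y | e v y] :&: A|.
  by rewrite -card_preimset_val; apply: eq_card => u; rewrite !inE.
apply; rewrite ?inE ?SubK //; first by move=> x y; rewrite !inE; apply: sXT.
move=> u /=; rewrite inE => euv ne; apply: inT => //; exact: valP.
Qed.

End Induced.

(** * Uncrossing and induction for finite relations *)

Lemma leq_card_disjoint (V : finType) (X Y Z : {set V}) :
  X \subset Z -> Y \subset Z -> [disjoint X & Y] -> #|X| + #|Y| <= #|Z|.
Proof.
move=> XZ YZ d; have /leqifP := leq_card_setU X Y; rewrite d => /eqP <-.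
by apply: subset_leq_card; rewrite subUset XZ.
Qed.

Lemma separated_bound_step (V : finType) (e : rel V) (A : {set V}) :
  reflexive e -> vertex_transitive e ->
  separated_bound_at (relpre (val : {x | x \in A} -> V) e) ->
  forall B, atomic e A B \/ atomic (reverse e) A B ->
  forall (X T : {set V}) v, v \in A -> separated e X T -> v \in X -> T != set0 ->
  (forall u, e u v -> u != v -> u \in T) ->
  #|X| + #|T| + #|[set y | e v y]| <= #|V|.+1.
Proof.
move=> e_refl tr bd B at_AB X T v vA sXT vX T0 inT.
have autE g : is_aut e g -> forall a b, e (g a) (g b) = e a b by move/is_autP.
have inout : #|[set y | e y v]| = #|[set y | e v y]|.
  by rewrite (invariant_card_eq (R := e) tr autE v v).
set O := [set y | e v y] in inout *; set I := [set y | e y v] in inout.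
have card_split (Z : {set V}) := cardsID A Z.
have nA := cardsC A.
(* Inside [A] the induced bound applies; outside [A], [T'] is disjoint from the out-neighbours of
   [v], as [v] lies in [X']. *)
have inside (X' T' : {set V}) : X' \subset A -> separated e X' T' -> v \in X' ->
    (forall u, e u v -> u != v -> u \in T') -> #|X'| + #|T'| + #|O| <= #|V|.+1.
  move=> XA s vX' inT'.
  have := separated_bound_induced bd s vX' vA (fun u _ => inT' u).
  have : #|T' :\: A| + #|O :\: A| <= #|~: A|.
    apply: leq_card_disjoint; rewrite ?setDE ?subsetIr //.
    rewrite -setI_eq0; apply/eqP/setP => y; rewrite !inE.
    case: (boolP (e v y)) => evy; rewrite ?andbF //=.
    by apply/negP => /andP[/andP[yT _] _]; move: (s _ _ vX' yT); rewrite evy.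
  rewrite (setIidPl XA); have := card_split O; have := card_split T'; rewrite -/O; lia.
have X0 : X != set0 by apply/set0Pn; exists v.
have XT x : x \in X -> x \in T -> False.
  by move=> xX xT; move: (sXT x x xX xT); rewrite e_refl.
case: at_AB => at_AB; have sAB := atomic_sep at_AB.
- case: (boolP (T :&: B == set0)) => TB0.
  + have TA y : y \in T -> [exists x in A, e x y].
      move=> yT; rewrite -(notin_atomicr at_AB); apply/negP => yB.
      by move/eqP/setP/(_ y): TB0; rewrite !inE yT yB.
    (* Exactly [#|B|] points have a block not reaching [v]. If the block of [x] in [X :\: A] reached
       [v], a path from [x] through [y] to [v] would put [y] in [T], against separation. *)
    have XM : #|X :\: A| <= #|B|.
      have := card_reach_block tr at_AB v; have := cardsC [set y | reach_block e A y v].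
      suff : #|X :\: A| <= #|~: [set y | reach_block e A y v]| by lia.
      apply/subset_leq_card/subsetP => x; rewrite !inE => /andP[xA xX].
      apply/negP => xv; have nxv : ~~ same_block e A x v.
        by rewrite same_block_sym (same_block_atom at_AB).
      have [y /and3P[xy exy eyv]] := reach_block_path e_refl tr at_AB xv nxv.
      have yT : y \in T by apply: inT => //; apply: contraNneq nxv => <-.
      by move: (sXT x y xX yT); rewrite exy.
    have := separated_bound_induced bd sXT vX vA (fun u _ => inT u).
    (* Both sets avoid [B], which pays for the [#|B|] lost on [X :\: A]. *)
    have : #|T :\: A| + #|O :\: A| <= #|~: A :\: B|.
      apply: leq_card_disjoint.
      * apply/subsetP => y; rewrite !inE (notin_atomicr at_AB) => /andP[-> yT].
        by rewrite TA.
      * apply/subsetP => y; rewrite !inE (notin_atomicr at_AB) => /andP[-> evy].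
        by rewrite andbT; apply/exists_inP; exists v.
      * rewrite -setI_eq0; apply/eqP/setP => y; rewrite !inE.
        case: (boolP (e v y)) => evy; rewrite ?andbF //=.
        by apply/negP => /andP[/andP[_ yT] _]; move: (sXT _ _ vX yT); rewrite evy.
    have BA : B \subset ~: A.
      apply/subsetP => y yB; rewrite inE; apply/negP => yA.
      by move: (sAB _ _ yA yB); rewrite e_refl.
    rewrite [#|~: A :\: B|]cardsD (setIidPr BA); have := subset_leq_card BA.
    have := card_split O; have := card_split T; have := card_split X; rewrite -/O; lia.
  (* The intersection pair falls under [inside], the union pair is bounded by maximality; the claim
     is the sum. *)
  + have sI : separated e (X :&: A) (T :|: B).
      by move=> x y /setIP[xX xA] /setUP[]; [apply: sXT|apply: sAB].
    have sU : separated e (X :|: A) (T :&: B).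
      by move=> x y /setUP[xX|xA] /setIP[yT yB]; [apply: sXT|apply: sAB].
    have := atomic_max at_AB sU; rewrite TB0 => /(_ _ isT).
    have -> : X :|: A != set0 by apply/set0Pn; exists v; rewrite inE vX.
    have := inside _ _ (subsetIr X A) sI; rewrite inE vX vA => /(_ isT) h /(_ isT).
    have := cardsUI X A; have := cardsUI T B.
    by have := h (fun u ev ne => subsetP (subsetUl T B) u (inT u ev ne)); lia.
- have tr' := vertex_transitive_reverse tr.
  case: (boolP (X :&: B == set0)) => XB0.
  (* A point [x] of [X] outside [A] would have an edge into [A]; reversed, [reach_block_path] from
     [v] gives edges from [x] to [y] and from [y] to [v]. Whether [y] is [v] or lies in [T],
     separation fails. *)
  + suff XA : X \subset A by apply: inside.
    apply/subsetP => x xX; apply: contraT => xA.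
    have xB : x \notin B.
      by apply/negP => xB; move/eqP/setP/(_ x): XB0; rewrite !inE xX xB.
    move: xB; rewrite (notin_atomicr at_AB) => /exists_inP[z zA ezx].
    have vx : reach_block (reverse e) A v x.
      by apply/existsP; exists z; rewrite (same_block_atom at_AB) // zA.
    have nvx : ~~ same_block (reverse e) A v x by rewrite (same_block_atom at_AB).
    have [y /and3P[_ eyv]] := reach_block_path (e := reverse e) e_refl tr' at_AB vx nvx.
    rewrite /reverse /= in eyv * => exy.
    have [yv|yv] := eqVneq y v.
      case: (@XT x) => //; apply: inT; first by rewrite -yv.
      by apply: contraNneq xA => ->.
    by move: (sXT x y xX (inT y eyv yv)); rewrite exy.
  (* The roles are exchanged: here maximality bounds [sI], and [sU] is estimated through the induced
     relation. *)
  + have sI : separated e (X :&: B) (T :|: A).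
      by move=> x y /setIP[xX xB] /setUP[yT|yA]; [apply: sXT|apply: sAB].
    have sU : separated e (X :|: B) (T :&: A).
      by move=> x y /setUP[xX|xB] /setIP[yT yA]; [apply: sXT|apply: sAB].
    have TA0 : T :|: A != set0 by apply/set0Pn; exists v; rewrite inE vA orbT.
    have := atomic_max at_AB (proj2 (separated_reverse _ _ _) sI) TA0 XB0.
    have := separated_bound_induced bd sU _ vA; rewrite inE vX => /(_ isT) h.
    have {h} := h (fun u uA ev ne => introT setIP (conj (inT u ev ne) uA)).
    (* In-neighbours of [v] outside [A] lie in [T], hence not in [X], and [B] has no edge into
       [A]. *)
    have : #|(X :|: B) :\: A| + #|I :\: A| <= #|~: A|.
      apply: leq_card_disjoint; rewrite ?setDE ?subsetIr //.
      rewrite -setI_eq0; apply/eqP/setP => y; rewrite !inE.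
      case: (boolP (e y v)) => eyv; rewrite ?andbF //=.
      apply/negP => /andP[/andP[/orP[yX|yB] yA] _].
        by apply: (XT y) => //; apply: inT => //; apply: contraNneq yA => ->.
      by move: (sAB _ _ vA yB); rewrite /reverse /= eyv.
    (* In- and out-degree of [v] agree globally and within [A], hence also outside [A]. *)
    have : #|I :&: A| = #|O :&: A| := card_block_in_out tr' at_AB vA.
    rewrite -[T :&: A :&: A]setIA setIid.
    have := cardsUI X B; have := cardsUI T A.
    have := card_split O; have := card_split I; have := card_split (X :|: B); rewrite -/O; lia.
Qed.

Lemma separated_bound (V : finType) (e : rel V) :
  reflexive e -> vertex_transitive e -> separated_bound_at e.
Proof.
have [n] := ubnP #|V|; elim: n V e => // n IH V e ltVn e_refl tr X T v sXT vX inT.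
have autE g : is_aut e g -> forall a b, e (g a) (g b) = e a b by move/is_autP.
case: (boolP (T == set0)) => [/eqP T0|T0].
  (* With [T] empty, [v] is its own only in-neighbour. *)
  have -> : #|[set y | e v y]| = 1.
    rewrite (invariant_card_eq (R := e) tr autE v v) -(cards1 v).
    apply: eq_card => y; rewrite !inE; apply/idP/eqP => [eyv|->//].
    by apply/eqP; apply: contraT => /(inT _ eyv); rewrite T0 inE.
  by rewrite T0 cards0 addn0 addn1 ltnS max_card.
have X0 : X != set0 by apply/set0Pn; exists v.
have tr' := vertex_transitive_reverse tr.
have [A [B [at_AB vA]]] : exists A B, (atomic e A B \/ atomic (reverse e) A B) /\ v \in A.
  have [A [B [at_AB|at_AB]]] := atomic_exists sXT X0 T0.
    by have [C [D [at_CD vC]]] := atomic_translate v tr at_AB; exists C, D; split=> //; left.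
  by have [C [D [at_CD vC]]] := atomic_translate v tr' at_AB; exists C, D; split=> //; right.
have blocks x y : x \in A -> y \in A ->
    exists g, [/\ is_aut e g, g @: A = A & g x = y].
  move=> xA yA; have [g ga gx] := tr x y; exists g; split=> //.
  have gA0 : A :&: g @: A != set0.
    by apply/set0Pn; exists y; rewrite inE yA -gx imset_f.
  case: at_AB => at_AB; first exact: (atomic_block at_AB).
  by apply: (atomic_block at_AB _ gA0); rewrite is_aut_reverse.
have ltAV : #|A| < #|V|.
  suff : ~: A != set0 by rewrite -card_gt0; have := cardsC A; lia.
  apply/set0Pn; case: at_AB => at_AB; have /set0Pn[b bB] := atomic_r0 at_AB.
    exists b; rewrite inE; apply/negP => bA.
    by move: (atomic_sep at_AB bA bB); rewrite e_refl.
  exists b; rewrite inE; apply/negP => bA.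
  by move: (atomic_sep at_AB bA bB); rewrite /reverse /= e_refl.
apply: (separated_bound_step e_refl tr _ at_AB vA) => //.
apply: IH; last exact: vertex_transitive_induced.
  by rewrite card_sig; apply: leq_trans ltAV _.
by move=> x; apply: e_refl.
Qed.

From mathcomp Require Import finmap boolp.

(** * Atoms of locally finite relations *)

Section LocallyFinite.
Local Open Scope fset_scope.
Local Open Scope nat_scope.
Variables (K : choiceType) (G : K -> {fset K}).
Hypothesis G_refl : forall x, x \in G x.
Hypothesis G_trans : forall x y, exists f,
  [/\ injective f, f x = y & forall a, G (f a) = f @` G a].

Definition nbhd (Y : {fset K}) : {fset K} := \bigcup_(x <- Y) G x.

Lemma nbhdP Y y : reflect (exists2 x, x \in Y & y \in G x) (y \in nbhd Y).
Proof.
by apply: (iffP (bigfcupP _ _ _ _)) => -[x]; rewrite ?andbT => xY yx; exists x; rewrite ?xY.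
Qed.

Lemma leq_card_nbhd Y : #|` Y| <= #|` nbhd Y|.
Proof. by apply/fsubset_leq_card/fsubsetP => y yY; apply/nbhdP; exists y. Qed.

Lemma card_nbhd_submodular Y Z :
  #|` nbhd (Y `&` Z)| + #|` nbhd (Y `|` Z)| <= #|` nbhd Y| + #|` nbhd Z|.
Proof.
rewrite -(cardfsUI (nbhd Y)) addnC; apply: leq_add.
  apply/fsubset_leq_card/fsubsetP => y /nbhdP[x /fsetUP[xY|xZ] yx].
    by apply/fsetUP; left; apply/nbhdP; exists x.
  by apply/fsetUP; right; apply/nbhdP; exists x.
apply/fsubset_leq_card/fsubsetP => y /nbhdP[x /fsetIP[xY xZ] yx].
by apply/fsetIP; split; apply/nbhdP; exists x.
Qed.

Lemma card_imfset_inj (f : K -> K) (Y : {fset K}) : injective f -> #|` f @` Y| = #|` Y|.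
Proof. exact: card_imfset. Qed.

Lemma nbhd_imfset (f : K -> K) Y :
  (forall a, G (f a) = f @` G a) -> nbhd (f @` Y) = f @` nbhd Y.
Proof.
move=> Gf; apply/fsetP => y; apply/nbhdP/imfsetP => [[_ /imfsetP[x xY ->]]|[z]].
  by rewrite Gf => /imfsetP[z zx ->]; exists z => //; apply/nbhdP; exists x.
move=> /nbhdP[x xY zx] ->; exists (f x); first by apply: in_imfset.
by rewrite Gf; apply: in_imfset.
Qed.

(** Minimality of the difference [#|] nbhd A| - #|[A|] is written with sums to avoid truncated
    subtraction. *)
Definition atom (A : {fset K}) : Prop :=
  [/\ A != fset0,
      forall Y : {fset K}, Y != fset0 -> #|` nbhd A| + #|` Y| <= #|` nbhd Y| + #|` A|
    & forall Y : {fset K}, Y != fset0 -> #|` nbhd A| + #|` Y| = #|` nbhd Y| + #|` A| ->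
      #|` A| <= #|` Y|].

(** Two successive minima; [leq_card_nbhd] makes the truncated differences exact. *)
Lemma atom_exists (v : K) : exists A, atom A.
Proof.
pose P n := `[< exists2 Y : {fset K}, Y != fset0 & #|` nbhd Y| - #|` Y| = n >].
have [|k /asboolP[Y0 Y0n0 Y0k] kmin] := @ex_minnP P.
  exists (#|` nbhd [fset v]| - #|` [fset v]|); apply/asboolP; exists [fset v] => //.
  by apply/fset0Pn; exists v; rewrite inE.
pose Q n := `[< exists Y : {fset K}, [/\ Y != fset0, #|` nbhd Y| - #|` Y| = k & #|` Y| = n] >].
have [|a /asboolP[A [A0 Ak Aa]] amin] := @ex_minnP Q.
  by exists #|` Y0|; apply/asboolP; exists Y0.
exists A; split=> // Y Y0'; have := leq_card_nbhd A; have := leq_card_nbhd Y.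
  suff : k <= #|` nbhd Y| - #|` Y| by lia.
  by apply: kmin; apply/asboolP; exists Y.
by move=> h1 h2 h3; rewrite Aa; apply: amin; apply/asboolP; exists Y; split=> //; lia.
Qed.

Lemma atom_imfset (f : K -> K) A : injective f ->
  (forall a, G (f a) = f @` G a) -> atom A -> atom (f @` A).
Proof.
move=> f_inj Gf [A0 A1 A2]; split.
- by rewrite -cardfs_gt0 card_imfset_inj // cardfs_gt0.
- by move=> Y; rewrite nbhd_imfset // !card_imfset_inj //; apply: A1.
- by move=> Y; rewrite nbhd_imfset // !card_imfset_inj //; apply: A2.
Qed.

Lemma atom_subset A C x : atom A -> atom C -> x \in A -> x \in C -> A `<=` C.
Proof.
move=> [A0 A1 A2] [C0 C1 C2] xA xC.
have I0 : A `&` C != fset0 by apply/fset0Pn; exists x; rewrite inE xA.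
have U0 : A `|` C != fset0 by apply/fset0Pn; exists x; rewrite inE xA.
have := card_nbhd_submodular A C; have := cardfsUI A C.
have := A1 _ C0; have := C1 _ A0; have := A1 _ I0; have := A1 _ U0 => *.
have h := A2 _ I0.
rewrite -fsubsetIidl; have /eqP -> // : A `&` C == A.
by rewrite eqEfcard fsubsetIl h //; lia.
Qed.

Theorem card_nbhd_lower_bound (X : {fset K}) v : v \in X ->
  (forall y, y \in nbhd X -> v \in G y -> y = v) ->
  #|` X| + #|` G v| <= #|` nbhd X| + 1.
Proof.
move=> vX Xv.
have [A at_A vA] : exists2 A, atom A & v \in A.
  have [A at_A] := atom_exists v; have [/fset0Pn[a aA] _ _] := at_A.
  have [f [f_inj <- Gf]] := G_trans a v.
  by exists (f @` A); [apply: atom_imfset|apply: in_imfset].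
have bd := @separated_bound A [rel a b | val b \in G (val a)].
(* The finite bound on [A], for [A] intersected with [X] and the part of [A] outside the image of
   that intersection. *)
have {bd} bd : #|` A `&` X| + #|` A `\` nbhd (A `&` X)| + #|` A `&` G v| <= #|` A|.+1.
  rewrite -!(card_fsub (B := A)) ?fsubsetIl ?fsubsetDl // fsubT cardsT.
  have -> : fsub A (A `&` G v) = [set b | [rel a b | val b \in G (val a)] [` vA] b].
    by apply/setP => b; rewrite in_fsub !inE fsvalP.
  apply: bd.
  - by move=> a /=.
  - move=> a b; have [f [f_inj fab Gf]] := G_trans (val a) (val b).
    (* The image of [A] is an atom meeting [A] in [val b], hence contained in [A]. *)
    have fA (u : A) : f (val u) \in A.
      have at_fA := atom_imfset f_inj Gf at_A.
      apply: (fsubsetP (atom_subset (x := val b) at_fA at_A _ _)); last exact: in_imfset (valP u).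
        by rewrite -fab; apply/in_imfset/valP.
      exact: valP.
    pose g (u : A) : A := [` fA u].
    have g_inj : injective g by move=> u u' /(congr1 val)/f_inj/val_inj.
    exists (perm g_inj); last by apply: val_inj; rewrite permE.
    by apply/is_autP => c d /=; rewrite !permE /= Gf mem_imfset.
  - move=> x y; rewrite !in_fsub !inE => /andP[xA xX] /andP[yn yA] /=.
    by apply: contra yn => yx; apply/nbhdP; exists (val x); rewrite // inE xA.
  - by rewrite in_fsub inE vA.
  - move=> u /= vu ne; rewrite in_fsub inE fsvalP andbT; apply: contra ne => un.
    apply/eqP/val_inj/Xv => //; case/nbhdP: un => x /fsetIP[_ xX] ux.
    by apply/nbhdP; exists x.
have [_ A1 _] := at_A.
(* Submodularity for [X] and [A], with minimality of [A] tested against the union, reduces the claim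
   to the intersection. *)
have XU0 : X `|` A != fset0 by apply/fset0Pn; exists v; rewrite inE vX.
have := A1 _ XU0; have := card_nbhd_submodular X A; have := cardfsUI X A.
rewrite ![X `&` A]fsetIC => *.
(* The finite bound counts only inside [A]; outside, the image contains the remaining neighbours of
   [v]. *)
have GN : G v `\` A `<=` nbhd (A `&` X) `\` A.
  apply/fsetSD/fsubsetP => y yv.
  by apply/nbhdP; exists v; rewrite // inE vA.
have := fsubset_leq_card GN.
have := cardfsID A (nbhd (A `&` X)); have := cardfsID (nbhd (A `&` X)) A.
have := cardfsID A (G v); rewrite ![_ `&` A]fsetIC => *; lia.
Qed.

End LocallyFinite.

(* Transfer from finite sets to classical sets *)
From mathcomp Require Import classical_sets functions cardinality.

Local Open Scope classical_set_scope.
Local Open Scope relation_scope.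

Lemma finite_xsection_relpow (V : Type) (E : set (V * V)) (k : nat) (v : V) :
  locally_finite_rel E -> finite_set (xsection (relpow E k) v).
Proof.
move=> lf; elim: k => [|k IHk]; first by rewrite xsection_relpow0; apply: finite_set1.
by rewrite xsection_relpowS; apply: bigcup_finite => // x _; apply: lf.
Qed.

Lemma xsection_relpow_refl (V : Type) (E : set (V * V)) (k : nat) (v : V) :
  rel_reflexive E -> xsection (relpow E k) v v.
Proof.
move=> rf; elim: k => [|k IHk]; first by rewrite xsection_relpow0.
by rewrite xsection_relpowS; exists v => //; apply/xsectionP.
Qed.

Lemma in_fset_setP (K : choiceType) (A : set K) (x : K) :
  finite_set A -> reflect (A x) (x \in fset_set A).
Proof. by move=> fA; rewrite in_fset_set //; apply: (iffP idP); rewrite inE. Qed.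

Theorem theorem1 (V : Type) (E : set (V * V)) (v : V) (j : nat) :
  point_symmetric E -> rel_reflexive E -> locally_finite_rel E ->
  (1 <= j)%N ->
  xsection (relpow E j) v `&` xsection (E^-1) v = [set v] ->
  (ncard (xsection (relpow E j) v) >=
   ncard (xsection (relpow E (j - 1)) v) + ncard (xsection E v) - 1)%N.
Proof.
move=> ps rf lf; case: j => // k _; rewrite (subn1 k.+1) /= => Ev.
pose G (x : {classic V}) : {fset {classic V}} :=
  fset_set (xsection E x : set {classic V}).
have inG x y : reflect (E (x, y)) (y \in G x).
  by apply: (iffP (@in_fset_setP {classic V} _ y (lf x))) => /xsectionP.
have inP i y : reflect (xsection (relpow E i) v y)
    (y \in fset_set (xsection (relpow E i) v : set {classic V})).
  exact: (@in_fset_setP {classic V} _ y (finite_xsection_relpow i v lf)).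
have G_refl x : x \in G x by apply/inG/rf.
have G_trans x y : exists f,
    [/\ injective f, f x = y & forall a, G (f a) = [fset f u | u in G a]%fset].
  have [f [[g fK gK] fE] fxy] := ps x y; exists f; split=> // [|a].
    exact: can_inj fK.
  apply/fsetP => z; apply/inG/imfsetP => [|[u /inG au ->]]; last exact: (proj1 (fE a u)).
  by rewrite -{1}(gK z) => /(proj2 (fE a (g z)))/inG az; exists (g z).
have nbhdE : nbhd G (fset_set (xsection (relpow E k) v : set {classic V})) =
    fset_set (xsection (relpow E k.+1) v : set {classic V}).
  apply/fsetP => y; apply/nbhdP/inP; rewrite xsection_relpowS.
    by move=> [x /inP vx /inG xy]; exists x => //; apply/xsectionP.
  by move=> [x vx /xsectionP xy]; exists x; [apply/inP|apply/inG].
have := @card_nbhd_lower_bound _ G G_refl G_trans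
  (fset_set (xsection (relpow E k) v : set {classic V})) v.
rewrite nbhdE /ncard leq_subLR [(1 + _)%N]addnC; apply.
  exact/inP/xsection_relpow_refl.
move=> y /inP vy /inG yv; suff : [set v] y by [].
by rewrite -Ev; split=> //; apply/xsectionP.
Qed.
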